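(* Let $R\subset\mathbb{R}^N$ be a nonempty finite set of nonzero vectors such that $x\in R\iff -x\in R$, and let $\mathcal{C}(R)=\bigcap_{x\in R}H_x$. Define $$\|y\|_{\mathcal{C}(R)}:=\max_{x\in R}\frac{\langle y,x\rangle}{\langle x,x\rangle},\qquad y\in\mathbb{R}^N.$$ Then $\|\cdot\|_{\mathcal{C}(R)}$ is a seminorm and $\mathcal{C}(R)$ is its unit ball: $$\mathcal{C}(R)=\{y\in\mathbb{R}^N:\|y\|_{\mathcal{C}(R)}\le1\}.$$ If the number of linearly independent vectors in $R$ is at least $N$, then the seminorm is a norm.
   Context: $\langle\cdot,\cdot\rangle$ is the standard Euclidean inner product. For a nonzero vector $x$, $H_x$ is the closed half-space containing the origin whose boundary is the hyperplane through $x$ with normal vector $x$, i.e. $H_x=\{y:\langle y,x\rangle\le\langle x,x\rangle\}$. *)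

(* Defs.v *)
From HB Require Import structures.
From mathcomp Require Import all_boot all_order all_algebra.
From mathcomp Require Import finmap.
From mathcomp Require Import all_classical all_reals.

Set Implicit Arguments.
Unset Strict Implicit.
Unset Printing Implicit Defensive.

Import Order.TTheory GRing.Theory Num.Theory.

Local Open Scope fset_scope.
Local Open Scope classical_set_scope.
Local Open Scope ring_scope.

Definition inner (R : realType) (N : nat) (u v : 'rV[R]_N) : R :=
  \sum_(i < N) u ord0 i * v ord0 i.

Definition half_space (R : realType) (N : nat) (x : 'rV[R]_N) :
  set 'rV[R]_N := [set y | inner y x <= inner x x].

Definition cell (R : realType) (N : nat) (S : {fset 'rV[R]_N}) :
  set 'rV[R]_N := \bigcap_(x in [set` S]) half_space x.

Definition ratio (R : realType) (N : nat) (y x : 'rV[R]_N) : R :=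
  inner y x / inner x x.

(* The maximum of [ratio y x] over [x \in S].  The starting value of the
   iterated maximum is itself one of these ratios when [S] is nonempty, so the
   value is the genuine maximum (it is not truncated below by 0).  For empty
   [S] the value is [ratio y 0 = 0]. *)
Definition cell_norm (R : realType) (N : nat) (S : {fset 'rV[R]_N})
    (y : 'rV[R]_N) : R :=
  \big[Num.max/ratio y (head 0 (enum_fset S))]_(x <- enum_fset S) ratio y x.

(* The library's [semiNormedZmodType] only asks for compatibility with integer
   multiples, hence these predicates with homogeneity over all real scalars. *)
Definition is_seminorm (R : realType) (V : lmodType R) (p : V -> R) : Prop :=
  [/\ forall y, 0 <= p y,
      forall (a : R) y, p (a *: y) = `|a| * p y
    & forall y z, p (y + z) <= p y + p z].

Definition is_norm (R : realType) (V : lmodType R) (p : V -> R) : Prop :=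
  is_seminorm p /\ forall y, p y = 0 -> y = 0.

(* Main.v *)
(* Symmetry of S turns the maximum of the ratios into the maximum of their
   absolute values. A vector of seminorm 0 is therefore orthogonal to S; when S
   spans the whole space, it is orthogonal to itself, hence 0. *)
Require Import Defs.
From HB Require Import structures.
From mathcomp Require Import all_boot all_order all_algebra.
From mathcomp Require Import finmap.
From mathcomp Require Import all_classical all_reals.

Set Implicit Arguments.
Unset Strict Implicit.
Unset Printing Implicit Defensive.

Import Order.TTheory GRing.Theory Num.Theory.

Local Open Scope fset_scope.
Local Open Scope classical_set_scope.
Local Open Scope ring_scope.

Section Inner.
Variables (R : realType) (N : nat).
Implicit Types (u v x y z : 'rV[R]_N) (a : R).

Lemma innerDl x y z : inner (y + z) x = inner y x + inner z x.
Proof.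
by rewrite /inner -big_split; apply: eq_bigr => i _; rewrite mxE mulrDl.
Qed.

Lemma innerZl x a y : inner (a *: y) x = a * inner y x.
Proof.
by rewrite /inner mulr_sumr; apply: eq_bigr => i _; rewrite mxE mulrA.
Qed.

Lemma innerC x y : inner x y = inner y x.
Proof. by apply: eq_bigr => i _; rewrite mulrC. Qed.

Lemma innerNr x y : inner y (- x) = - inner y x.
Proof. by rewrite innerC -scaleN1r innerZl mulN1r innerC. Qed.

Lemma inner_ge0 x : 0 <= inner x x.
Proof. by apply: sumr_ge0 => i _; rewrite -expr2 sqr_ge0. Qed.

Lemma inner_eq0 x : (inner x x == 0) = (x == 0).
Proof.
apply/eqP/eqP => [/psumr_eq0P x0|->]; last first.
  by apply: big1 => i _; rewrite mxE mul0r.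
apply/rowP => i; rewrite mxE; apply/eqP; rewrite -sqrf_eq0 expr2.
by rewrite x0// => j _; rewrite -expr2 sqr_ge0.
Qed.

Lemma inner_gt0 x : (0 < inner x x) = (x != 0).
Proof. by rewrite lt_def inner_ge0 andbT inner_eq0. Qed.

(* Unqualified, [ratio] is the type of fractions of mathcomp.algebra.fraction. *)
Lemma ratioDl x y z : Defs.ratio (y + z) x = Defs.ratio y x + Defs.ratio z x.
Proof. by rewrite /Defs.ratio innerDl mulrDl. Qed.

Lemma ratioZl x a y : Defs.ratio (a *: y) x = a * Defs.ratio y x.
Proof. by rewrite /Defs.ratio innerZl mulrA. Qed.

(** The numerator is odd in [x] and the denominator is even. *)
Lemma ratioNr x y : Defs.ratio y (- x) = - Defs.ratio y x.
Proof. by rewrite /Defs.ratio !innerNr (innerC (- x)) innerNr opprK mulNr. Qed.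

Lemma ratio_le1 x y : x != 0 -> (Defs.ratio y x <= 1) = (inner y x <= inner x x).
Proof. by move=> x0; rewrite /Defs.ratio ler_pdivrMr ?inner_gt0// mul1r. Qed.

Lemma ratio_eq0 x y : x != 0 -> (Defs.ratio y x == 0) = (inner y x == 0).
Proof. by move=> x0; rewrite /Defs.ratio mulf_eq0 invr_eq0 inner_eq0 (negPf x0) orbF. Qed.

(** A free family spans a subspace of dimension [size X], and a subspace whose dimension reaches
    that of the whole space, here [1 * N], is the whole space. *)
Lemma span_full_rV (X : seq 'rV[R]_N) :
  free X -> (N <= size X)%N -> <<X>>%VS = fullv.
Proof.
move=> freeX leNX; apply/eqP; rewrite eqEdim subvf dimvf /= dim_matrix mul1r.
by move: freeX; rewrite /free => /eqP ->.
Qed.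

(** Expand [z] in its coordinates along [X]; by linearity every term of the inner product
    vanishes. *)
Lemma orthogonal_span (X : seq 'rV[R]_N) y z :
  {in X, forall x, inner y x = 0} -> z \in <<X>>%VS -> inner y z = 0.
Proof.
move=> yX /(@coord_span _ _ _ (in_tuple X)) ->; rewrite innerC.
elim/big_rec: _ => [|i u _ IH]; first by apply: big1 => i _; rewrite mxE mul0r.
by rewrite innerDl IH addr0 innerZl innerC yX ?mulr0 ?mem_nth.
Qed.

End Inner.

Section CellNorm.
Variables (R : realType) (N : nat) (S : {fset 'rV[R]_N}).
Implicit Types (x y z : 'rV[R]_N) (a c : R).

Lemma ratio_le_cell_norm x y : x \in S -> Defs.ratio y x <= cell_norm S y.
Proof. by move=> xS; apply: le_bigmax_seq. Qed.

Hypothesis S_nonempty : S != fset0.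

Lemma cell_norm_leP y c :
  cell_norm S y <= c <-> forall x, x \in S -> Defs.ratio y x <= c.
Proof.
split=> [pc x xS|h]; first exact: le_trans (ratio_le_cell_norm y xS) pc.
rewrite /cell_norm big_seq; apply: bigmax_le => [|x xS]; apply: h => //.
(* The starting value of the iterated maximum must be bounded by [c] too. As [S] has a member, the
   head of its enumeration is no default value but an element of [S], so the bound applies to it. *)
have /fset0Pn[x] := S_nonempty.
change (x \in enum_fset S -> head 0 (enum_fset S) \in enum_fset S).
by case: (enum_fset S) => //= u s _; rewrite mem_head.
Qed.

(** For nonzero [x], dividing by [inner x x > 0] turns the half-space inequality into a ratio at
    most 1; a maximum is at most 1 exactly when all ratios are. *)
Lemma cell_unit_ball : (forall x, x \in S -> x != 0) ->
  cell S = [set y | cell_norm S y <= 1].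
Proof.
move=> S_nonzero; apply/seteqP; split=> y /= => [Sy|/cell_norm_leP Sy x /= xS].
  by apply/cell_norm_leP => x xS; rewrite ratio_le1 ?S_nonzero//; exact: Sy.
by rewrite /half_space /= -ratio_le1 ?Sy ?S_nonzero.
Qed.

Hypothesis S_symmetric : forall x, x \in S <-> - x \in S.

(** The opposite of the ratio at [x] is the ratio at [- x], which also competes in the maximum. *)
Lemma normr_ratio_le_cell_norm x y : x \in S -> `|Defs.ratio y x| <= cell_norm S y.
Proof.
move=> xS; rewrite ler_norml lerNl -ratioNr !ratio_le_cell_norm//.
exact: (S_symmetric x).1.
Qed.

Lemma cell_norm_ge0 y : 0 <= cell_norm S y.
Proof.
have /fset0Pn[x xS] := S_nonempty.
exact: le_trans (normr_ge0 _) (normr_ratio_le_cell_norm y xS).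
Qed.

Lemma cell_normD y z : cell_norm S (y + z) <= cell_norm S y + cell_norm S z.
Proof.
by apply/cell_norm_leP => x xS; rewrite ratioDl lerD ?ratio_le_cell_norm.
Qed.

Lemma cell_normZ_le a y : cell_norm S (a *: y) <= `|a| * cell_norm S y.
Proof.
apply/cell_norm_leP => x xS; rewrite ratioZl (le_trans (ler_norm _))//.
by rewrite normrM ler_wpM2l ?normr_ratio_le_cell_norm.
Qed.

Lemma cell_normZ a y : cell_norm S (a *: y) = `|a| * cell_norm S y.
Proof.
apply/le_anti; rewrite cell_normZ_le /=.
have [->|a0] := eqVneq a 0; first by rewrite normr0 mul0r cell_norm_ge0.
(* The reverse inequality is [cell_normZ_le] for the scalar [a^-1] and the vector [a *: y], whose
   product is [y]. *)
rewrite -ler_pdivlMl ?normr_gt0// -normfV.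
by rewrite -{1}[y](scalerK a0) cell_normZ_le.
Qed.

Lemma cell_norm_seminorm : is_seminorm (cell_norm S).
Proof. by split; [exact: cell_norm_ge0|exact: cell_normZ|exact: cell_normD]. Qed.

(** A zero maximum alone makes the ratios nonpositive; the bound on absolute values makes them
    vanish. *)
Lemma cell_norm_eq0_orthogonal x y : x \in S -> x != 0 -> cell_norm S y = 0 ->
  inner y x = 0.
Proof.
move=> xS x0 y0; apply/eqP; rewrite -ratio_eq0// -normr_le0 -y0.
exact: normr_ratio_le_cell_norm.
Qed.

End CellNorm.

Theorem lemma3p1 (R : realType) (N : nat) (S : {fset 'rV[R]_N})
    (S_nonempty : S != fset0)
    (S_nonzero : forall x : 'rV[R]_N, x \in S -> x != 0)
    (S_symmetric : forall x : 'rV[R]_N, x \in S <-> - x \in S) :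
  [/\ is_seminorm (cell_norm S),
      cell S = [set y : 'rV[R]_N | cell_norm S y <= 1]
    & (exists X : seq 'rV[R]_N,
         [/\ {subset X <= S}, free X & (N <= size X)%N]) ->
      is_norm (cell_norm S)].
Proof.
split; [exact: cell_norm_seminorm|exact: cell_unit_ball|].
move=> [X [XS freeX leNX]]; split; first exact: cell_norm_seminorm.
move=> y y0; apply/eqP; rewrite -inner_eq0; apply/eqP.
apply: (@orthogonal_span _ _ X); last by rewrite span_full_rV ?memvf.
by move=> x /XS xS; apply: (@cell_norm_eq0_orthogonal _ _ S) => //; exact: S_nonzero.
Qed.
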